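(* Let $n \geq 3$ be a prime and let $G$ be the graph $G=G_n$ on $2n^2-n$ vertices defined in the context. Then \[ \chi_{\ell}(G^2) - \chi(G^2) \geq n-1. \]
   Context: Graphs are finite and simple. $[n]=\{1,\dots,n\}$. The square $G^2$ of a graph $G$ has vertex set $V(G)$, and two distinct vertices are adjacent in $G^2$ iff their distance in $G$ is at most $2$. $\chi$ is the chromatic number. The list chromatic number $\chi_\ell(H)$ is the least $k$ such that for every assignment $L$ of lists of colors with $|L(v)|\ge k$ for all $v\in V(H)$ there is a proper coloring $\phi$ of $H$ with $\phi(v)\in L(v)$ for all $v$. Construction of $G$ (for a prime $n\ge 3$). For $i\in[n-1]$ and $(j,k)\in[n]\times[n]$ let $L_i(j,k)\in[n]$ be the unique element of $[n]$ congruent to $j+i(k-1)$ modulo $n$. The vertex set of $G$ consists of $2n^2-n$ distinct vertices: $V(G)=P_1\cup\cdots\cup P_n\cup Q_1\cup\cdots\cup Q_{n-1}$, where $P_i=\{v_{i,1},\dots,v_{i,n}\}$ for $1\le i\le n$ and $Q_j=\{w_{j,1},\dots,w_{j,n}\}$ for $1\le j\le n-1$. For $1\le j\le n$ let $T_j=\{v_{1,j},v_{2,j},\dots,v_{n,j}\}$. The edge set is $E(G)=E_1\cup E_2$, where $E_1=\bigcup_{i\in[n-1]}\bigcup_{j\in[n]}\{w_{i,j}v_{k,L_i(j,k)}:1\le k\le n\}$ and $E_2=\bigcup_{j\in[n]}\{xy: x,y\in T_j,\ x\ne y\}$. *)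

(* Defs.v *)
From mathcomp Require Import all_boot finmap boolp.

Set Implicit Arguments.
Unset Strict Implicit.
Unset Printing Implicit Defensive.

Record sgraph := SGraph {
  svertex :> finType;
  sedge : rel svertex;
  sedge_sym : symmetric sedge;
  sedge_irr : irreflexive sedge
}.

Section GraphNotions.

Variable G : sgraph.

(* The distance from [x] to [y] is at most [d] iff some walk with at most [d]
   edges joins them; in particular this fails when [y] is unreachable. *)
Definition dist_le (d : nat) (x y : G) : bool :=
  [exists m : 'I_d.+1, exists p : m.-tuple G,
     path (@sedge G) x p && (last x p == y)].

Lemma dist_leP d x y :
  reflect (exists p : seq G,
             [/\ path (@sedge G) x p, last x p = y & size p <= d])
          (dist_le d x y).
Proof.
apply: (iffP existsP) => [[m /existsP [p /andP [xp /eqP yp]]]|[p [xp yp sp]]].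
  by exists p; split; rewrite ?size_tuple -1?ltnS.
by exists (Ordinal (sp : size p < d.+1)); apply/existsP; exists (in_tuple p);
  rewrite xp yp eqxx.
Qed.

Lemma dist_le_sym d : symmetric (dist_le d).
Proof.
suff imp x y : dist_le d x y -> dist_le d y x.
  by move=> x y; apply/idP/idP; apply: imp.
case/dist_leP=> p [xp yp sp]; apply/dist_leP; exists (rev (belast x p)); split.
- rewrite -yp rev_path (eq_path (e' := @sedge G)) // => u v; exact: sedge_sym.
- by case: p {xp sp} yp => [|z p] //= _; rewrite rev_cons last_rcons.
- by rewrite size_rev size_belast.
Qed.

Definition square_edge (x y : G) : bool := (x != y) && dist_le 2 x y.

Lemma square_edge_sym : symmetric square_edge.
Proof. by move=> x y; rewrite /square_edge eq_sym dist_le_sym. Qed.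

Lemma square_edge_irr : irreflexive square_edge.
Proof. by move=> x; rewrite /square_edge eqxx. Qed.

Definition square : sgraph := SGraph square_edge_sym square_edge_irr.

Definition proper_coloring (C : eqType) (phi : G -> C) : Prop :=
  forall x y, sedge x y -> phi x != phi y.

Definition colorable (k : nat) : Prop :=
  exists phi : G -> 'I_k, proper_coloring phi.

Definition choosable (k : nat) : Prop :=
  forall (C : choiceType) (L : G -> {fset C}),
    (forall v, k <= #|` L v|) ->
    exists phi : G -> C, proper_coloring phi /\ forall v, phi v \in L v.

Lemma colorable_card : colorable #|G|.
Proof.
exists enum_rank => x y exy; apply/eqP => /enum_rank_inj xy.
by rewrite xy sedge_irr in exy.
Qed.

Lemma choosable_card : choosable #|G|.
Proof.
move=> C L cardL.
have step (s : seq G) : uniq s ->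
    exists phi : G -> C, {in s &, injective phi} /\ {in s, forall v, phi v \in L v}.
  elim: s => [_|v s IHs /= /andP [vs us]].
    case: (pickP G) => [v _|no_v].
      have /fset0Pn [c _] : L v != fset0.
        by rewrite -cardfs_gt0 (leq_trans _ (cardL v)) //; apply/card_gt0P; exists v.
      by exists (fun=> c).
    have noG (v : G) : C by move: (no_v v); rewrite inE.
    by exists noG.
  have [phi [phi_inj phiL]] := IHs us.
  pose used := [fset c in map phi s]%fset.
  have /fset0Pn [c] : (L v `\` used)%fset != fset0.
    apply/negP; rewrite fsetD_eq0 => /fsubset_leq_card /(leq_trans (cardL v)).
    rewrite leqNgt => /negP; apply.
    apply: leq_ltn_trans (_ : size s < _).
      by rewrite card_fseq (leq_trans (size_undup _)) ?size_map.
    have /card_uniqP vs_card : uniq (v :: s) by rewrite /= vs.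
    by rewrite -[(size s).+1]/(size (v :: s)) -vs_card max_card.
  rewrite !inE => /andP [c_new cL].
  have neq x : x \in s -> (x == v) = false.
    by move=> xs; apply/eqP => xv; rewrite -xv xs in vs.
  have new x : x \in s -> phi x <> c.
    by move=> xs xc; rewrite -xc map_f in c_new.
  exists (fun x => if x == v then c else phi x); split.
    move=> x y; rewrite !inE.
    case: (x =P v) => [->|_]; case: (y =P v) => [->|_] //= xs ys.
    - by move=> /esym /(new _ ys).
    - by move=> /(new _ xs).
    - exact: phi_inj.
  by move=> x; rewrite inE; case: (x =P v) => [->|_] //=; apply: phiL.
have [phi [phi_inj phiL]] := step _ (enum_uniq G).
exists phi; split=> [x y exy|v]; last by rewrite phiL ?mem_enum.
apply/eqP => /phi_inj xy; rewrite xy ?mem_enum // in exy.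
by rewrite sedge_irr in exy.
Qed.

Lemma ex_colorable : exists k, `[< colorable k >].
Proof. by exists #|G|; apply/asboolP; exact: colorable_card. Qed.

Lemma ex_choosable : exists k, `[< choosable k >].
Proof. by exists #|G|; apply/asboolP; exact: choosable_card. Qed.

Definition chromatic_number : nat := ex_minn ex_colorable.

Definition list_chromatic_number : nat := ex_minn ex_choosable.

End GraphNotions.

Section Construction.

Variable n : nat.

(* The index a in [n] = {1, ..., n} is represented by the ordinal a - 1, and
   likewise for [n-1]: i : 'I_n.-1 stands for i.+1, and so on.  Hence the
   element of [n] congruent to j + i (k - 1) becomes the residue of
   j + i.+1 * k, cf. [latinP]. *)
Definition latin (i : 'I_n.-1) (j k : 'I_n) : 'I_n :=
  Ordinal (ltn_pmod (j + i.+1 * k) (leq_ltn_trans (leq0n j) (ltn_ord j))).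

Lemma latinP (i : 'I_n.-1) (j k l : 'I_n) :
  (l == latin i j k) = (l.+1 == j.+1 + i.+1 * (k.+1 - 1) %[mod n]).
Proof.
rewrite -val_eqE /= subn1 /= addSn -[l.+1]addn1 -[(_ + _).+1]addn1 eqn_modDr.
by rewrite (modn_small (ltn_ord l)).
Qed.

(* [inl (i, j)] is v_{i,j} and [inr (i, j)] is w_{i,j}. *)
Definition Gvertex : finType := (('I_n * 'I_n) + ('I_n.-1 * 'I_n))%type.

Lemma card_Gvertex : #|{: Gvertex}| = 2 * n ^ 2 - n.
Proof.
rewrite card_sum !card_prod !card_ord -subn1 mulnBl mul1n mulnn.
rewrite addnBA ?mul2n ?addnn // -mulnn.
by case: (n) => // m; rewrite leq_pmulr.
Qed.

Definition Gedge (x y : Gvertex) : bool :=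
  match x, y with
  | inr (i, j), inl (k, l) | inl (k, l), inr (i, j) => l == latin i j k
  | inl (i, j), inl (i', j') => (j == j') && (i != i')
  | inr _, inr _ => false
  end.

Lemma Gedge_sym : symmetric Gedge.
Proof.
by move=> [[i j]|[i j]] [[i' j']|[i' j']] //=; rewrite eq_sym [i == _]eq_sym.
Qed.

Lemma Gedge_irr : irreflexive Gedge.
Proof. by move=> [[i j]|[i j]] //=; rewrite !eqxx. Qed.

Definition Ggraph : sgraph := SGraph Gedge_sym Gedge_irr.

End Construction.

(* Main.v *)
(** The square of [G_n] is the complete multipartite graph with the [2n-1] parts
    P_1, ..., P_n, Q_1, ..., Q_{n-1} of size [n]: vertices of one part have no
    common neighbour, and two vertices of distinct parts are adjacent or have a
    common neighbour because a linear congruence modulo the prime [n] is solvable.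
    Hence chi <= 2n-1.  For the list chromatic number, take [3n] colours in [n]
    blocks of three and give the [j]-th vertex of each part all colours outside
    block [j].  No colour is available on a whole part, so every part uses two
    colours, and these differ between parts; but 2(2n-1) > 3n.  Hence
    chi_l > 3(n-1). *)
Require Import Defs.
From mathcomp Require Import all_boot all_order all_algebra.
From mathcomp Require Import finmap boolp zify.

Import Order.TTheory GRing.Theory Num.Theory.
Local Open Scope ring_scope.

Lemma chromatic_number_le (H : sgraph) k :
  colorable H k -> (chromatic_number H <= k)%N.
Proof.
move=> col; rewrite /chromatic_number; case: ex_minnP => m _; apply.
exact/asboolP.
Qed.

Lemma choosable_list_chromatic_number (H : sgraph) :
  choosable H (list_chromatic_number H).
Proof. by rewrite /list_chromatic_number; case: ex_minnP => m /asboolP. Qed.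

Lemma colorable_parts (H : sgraph) (P : finType) (part : H -> P) :
  (forall x y, sedge x y -> part x != part y) -> colorable H #|P|.
Proof.
move=> edge_part; exists (enum_rank \o part) => x y /edge_part /=.
by rewrite (inj_eq enum_rank_inj).
Qed.

(* [pos x] is the position of [x] within its part, [vtx p j] the vertex of
   part [p] in position [j]. *)
Lemma multipartite_choosable (H : sgraph) (P : finType) (n s k : nat)
    (vtx : P -> 'I_n -> H) (pos : H -> 'I_n) :
  (0 < n)%N -> (n * s < 2 * #|P|)%N ->
  (forall p j, pos (vtx p j) = j) ->
  (forall p q i j, p != q -> sedge (vtx p i) (vtx q j)) ->
  choosable H k -> ((n - 1) * s < k)%N.
Proof.
move=> n_gt0 lt_ns posK edge_vtx chooseH; rewrite ltnNge; apply/negP => le_k.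
pose avail (x : H) := [pred c : 'I_n * 'I_s | c.1 != pos x].
pose L x := [fset c in enum (avail x)]%fset.
have cardL x : (k <= #|` L x|)%N.
  apply: leq_trans le_k _.
  rewrite card_fseq undup_id ?enum_uniq // -cardE.
  rewrite (eq_card (B := predX (predC1 (pos x)) predT)); last first.
    by move=> c; rewrite !inE andbT.
  by rewrite cardX cardC1 !card_ord subn1.
have [phi [phi_proper phiL]] := chooseH _ L cardL.
have phi_block x : (phi x).1 != pos x.
  by have := phiL x; rewrite !inE mem_enum inE.
pose o := Ordinal n_gt0.
(* Two vertices per part: the one in position [o], and the one whose position is the block of the
   colour at [o]. The list of the latter excludes that block, so their colours differ. *)
pose rep (u : P * bool) := if u.2 then vtx u.1 (phi (vtx u.1 o)).1 else vtx u.1 o.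
have phi_rep_inj : injective (phi \o rep).
  move=> [p b] [q c] /= eq_phi; case: (eqVneq p q) => [eq_pq|neq_pq]; last first.
    suff /phi_proper : sedge (rep (p, b)) (rep (q, c)) by rewrite eq_phi eqxx.
    by rewrite /rep; case: b {eq_phi}; case: c; exact: edge_vtx.
  move: eq_phi; rewrite eq_pq /rep /=.
  have := phi_block (vtx q (phi (vtx q o)).1); rewrite posK => /eqP two_colors.
  case: b; case: c => //= /(congr1 fst) eq_block; first by case: two_colors.
  by case: two_colors; rewrite -eq_block.
have := leq_card _ phi_rep_inj.
by rewrite !card_prod !card_ord card_bool mulnC leqNgt lt_ns.
Qed.

Lemma square_edgeP (H : sgraph) (x y : H) :
  reflect (x != y /\ (sedge x y \/ exists2 z, sedge x z & sedge z y))
          (square_edge x y).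
Proof.
apply: (iffP andP) => -[neq_xy h]; split=> //.
  case/dist_leP: h => -[|z [|t [|u p]]] [] //= xp lastp _.
  - by rewrite lastp eqxx in neq_xy.
  - by left; rewrite -lastp; case/andP: xp.
  - by right; exists z; case/and3P: xp => // _; rewrite lastp.
apply/dist_leP; case: h => [xy|[z xz zy]].
  by exists [:: y]; rewrite /= xy.
by exists [:: z; y]; rewrite /= xz zy.
Qed.

(** The map sending [k] to [a + c * k] modulo [n] is injective on ['I_n] because [c] is invertible,
    hence bijective by finiteness. *)
Lemma linear_congruence n (c a b : nat) : (0 < n)%N -> coprime n c ->
  exists k : 'I_n, a + c * k = b %[mod n].
Proof.
move=> n_gt0 co_nc; pose f (k : 'I_n) := Ordinal (ltn_pmod (a + c * k) n_gt0).
have f_inj : injective f.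
  move=> k l [] /eqP; rewrite eqn_modDl.
  wlog le_kl : k l / (k <= l)%N.
    by case/orP: (leq_total k l) => /[swap] wl /wl // + /[1! eq_sym] => h /h.
  rewrite eq_sym eqn_mod_dvd ?leq_mul2l ?le_kl ?orbT // -mulnBr Gauss_dvdr // => dvd.
  apply/val_inj/eqP; rewrite eqn_leq le_kl /= -subn_eq0.
  apply/negPn/negP => nz; have := dvdn_leq _ dvd; rewrite lt0n => /(_ nz).
  by rewrite leqNgt (leq_ltn_trans (leq_subr _ _)).
have [g _ gK] := injF_bij f_inj.
by exists (g (Ordinal (ltn_pmod b n_gt0))); have [] := gK (Ordinal (ltn_pmod b n_gt0)).
Qed.

Section SquareOfG.

Variable n : nat.
Hypothesis n_prime : prime n.

Let n_gt0 : (0 < n)%N := prime_gt0 n_prime.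

Definition Gpart (x : Ggraph n) : 'I_n + 'I_n.-1 :=
  match x with inl (i, _) => inl i | inr (i, _) => inr i end.

Definition Gpos (x : Ggraph n) : 'I_n :=
  match x with inl (_, j) | inr (_, j) => j end.

Definition Gvtx (p : 'I_n + 'I_n.-1) (j : 'I_n) : Ggraph n :=
  match p with inl i => inl (i, j) | inr i => inr (i, j) end.

Lemma latin_eq i (j k l : 'I_n) :
  (l == latin i j k) = (j + i.+1 * k == l %[mod n]).
Proof. by rewrite -val_eqE /= eq_sym (modn_small (ltn_ord l)). Qed.

Lemma prime_coprime_small c : (0 < c < n)%N -> coprime n c.
Proof.
by case/andP=> c_gt0 c_lt; rewrite prime_coprime // gtnNdvd.
Qed.

Lemma ltn_predS (i : 'I_n.-1) : (i.+1 < n)%N.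
Proof. by have := ltn_ord i; lia. Qed.

(** The slope [i.+1] lies strictly between 0 and [n], so it is invertible: every w-vertex has a
    neighbour in each clique T_l. *)
Lemma latin_surj i j l : exists k, l = latin i j k :> 'I_n.
Proof.
have [|k /eqP] := @linear_congruence n i.+1 j l n_gt0.
  exact/prime_coprime_small/ltn_predS.
by rewrite -latin_eq => /eqP; exists k.
Qed.

(** Two lines of distinct slopes meet: for [i' < i], equating them leaves a congruence with
    invertible coefficient [i - i']. This gives w-vertices of different parts a common neighbour. *)
Lemma latin_meet i i' j j' : i != i' ->
  exists k, latin i j k = latin i' j' k :> 'I_n.
Proof.
wlog lt_ii' : i i' j j' / (i' < i)%N.
  move=> wl neq; case: (ltngtP i i') => [lt|lt|/val_inj eq_ii'].
  - by have [|k] := wl _ _ j' j lt; rewrite 1?eq_sym //; exists k.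
  - exact: wl.
  - by rewrite eq_ii' eqxx in neq.
move=> _; have [|k k_eq] := @linear_congruence n (i - i') j j' n_gt0.
  by apply: prime_coprime_small; have := ltn_predS i; lia.
exists k; apply: val_inj => /=.
have -> : (j + i.+1 * k = (j + (i - i') * k) + i'.+1 * k)%N.
  by rewrite -addnA -mulnDl; congr (_ + _ * _)%N; lia.
by rewrite -modnDml k_eq modnDml.
Qed.

(** The line through two points differing in both coordinates is a w-vertex adjacent to both of the
    corresponding v-vertices. *)
Lemma latin_through (k k' l l' : 'I_n) : k != k' -> l != l' ->
  exists i j, l = latin i j k /\ l' = latin i j k'.
Proof.
wlog lt_kk' : k k' l l' / (k' < k)%N.
  move=> wl nk nl; case: (ltngtP k k') => [lt|lt|/val_inj eq_kk'].
  - by have [||i [j []]] := wl _ _ l' l lt; rewrite 1?eq_sym //; exists i, j.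
  - exact: wl.
  - by rewrite eq_kk' eqxx in nk.
move=> _ neq_ll'.
have [|c c_eq] := @linear_congruence n (k - k') l' l n_gt0.
  by apply: prime_coprime_small; have := ltn_ord k; lia.
(* The slope [c] must be nonzero, since index [i] encodes slope [i.+1]; slope 0 would force
   [l = l']. *)
have c_gt0 : (0 < c)%N.
  rewrite lt0n; apply: contra neq_ll' => /eqP c0; move: c_eq.
  by rewrite c0 muln0 addn0 !modn_small // => /val_inj ->.
(* Coefficient 1 serves to subtract modulo [n]: [j] is the residue of [l - c * k]. *)
have [|j j_eq] := @linear_congruence n 1 (c * k) l n_gt0; first exact: coprimen1.
have c_lt : (c.-1 < n.-1)%N by have := ltn_ord c; lia.
have jkl : j + c * k = l %[mod n] by rewrite addnC -j_eq mul1n.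
exists (Ordinal c_lt), j; split; apply/eqP; rewrite latin_eq /= prednK //.
  exact/eqP.
rewrite -(eqn_modDr ((k - k') * c)) c_eq -jkl; apply/eqP; congr (_ %% _)%N.
by rewrite -addnA [((k - k') * c)%N]mulnC -mulnDr; congr (_ + _ * _)%N; lia.
Qed.

Lemma latin_inj i (j j' k : 'I_n) : latin i j k = latin i j' k -> j = j'.
Proof.
move=> [] /eqP; rewrite eqn_modDr !modn_small // => /eqP; exact: val_inj.
Qed.

(** A vertex has at most one neighbour in each part other than its own: a v-vertex fixes the column,
    and a w-vertex meets each P_i once. *)
Lemma square_edge_parts (x y : Ggraph n) : square_edge x y -> Gpart x != Gpart y.
Proof.
case/square_edgeP => neq_xy adj; apply/eqP => eq_part.
move: x y neq_xy adj eq_part.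
case=> -[i j] [] [i' j'] //= neq_xy adj [] eq_i; rewrite -{i'}eq_i in neq_xy adj *.
  case/negP: neq_xy; case: adj => [|[]]; first by rewrite eqxx andbF.
  case=> -[k l] /=.
    by move=> /andP [/eqP -> _] /andP [/eqP -> _].
  by move=> /eqP -> /eqP ->.
case/negP: neq_xy; case: adj => // -[] [] [k l] //= /eqP -> /eqP eq_l.
by rewrite (latin_inj _ _ _ _ eq_l).
Qed.

Lemma parts_square_edge (x y : Ggraph n) : Gpart x != Gpart y -> square_edge x y.
Proof.
have mixed (k l j : 'I_n) i : square_edge (inl (k, l) : Ggraph n) (inr (i, j)).
  apply/square_edgeP; split=> //.
  (* The neighbour of w_{i,j} in the clique T_l is either v_{k,l} itself or adjacent to it. *)
  have [k' l_eq] := latin_surj i j l.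
  case: (eqVneq k k') => [eq_k|neq_k]; first by left; rewrite /= eq_k l_eq.
  by right; exists (inl (k', l)); rewrite /= ?eqxx // l_eq.
case: x y => [[i j]|[i j]] [[i' j']|[i' j']] /= neq_part.
- have neq_i : i != i' by apply: contraNneq neq_part => ->.
  apply/square_edgeP; split; first by apply: contraNneq neq_i => -[->].
  case: (eqVneq j j') => [->|neq_j]; first by left; rewrite /= eqxx.
  have [a [b [-> ->]]] := latin_through _ _ _ _ neq_i neq_j.
  by right; exists (inr (a, b)) => /=.
- exact: mixed.
- by rewrite square_edge_sym.
- have neq_i : i != i' by apply: contraNneq neq_part => ->.
  apply/square_edgeP; split; first by apply: contraNneq neq_i => -[->].
  have [k eq_k] := latin_meet _ _ j j' neq_i.
  by right; exists (inl (k, latin i j k)) => /=; rewrite ?eq_k.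
Qed.

End SquareOfG.

Theorem theorem2p11 (n : nat) (n_ge3 : (3 <= n)%N) (n_prime : prime n) :
  (list_chromatic_number (square (Ggraph n)))%:Z
    - (chromatic_number (square (Ggraph n)))%:Z >= n%:Z - 1.
Proof.
have card_parts : #|{: 'I_n + 'I_n.-1}| = (n + n.-1)%N by rewrite card_sum !card_ord.
have chi_le : (chromatic_number (square (Ggraph n)) <= n + n.-1)%N.
  rewrite -card_parts; apply: chromatic_number_le.
  exact: (@colorable_parts (square (Ggraph n)) _ (Gpart n) (square_edge_parts n)).
have chil_gt : ((n - 1) * 3 < list_chromatic_number (square (Ggraph n)))%N.
  apply: (@multipartite_choosable (square (Ggraph n)) _ n 3 _ (Gvtx n) (Gpos n)).
  - exact: prime_gt0.
  (* The inequality 3n < 2(2n-1) amounts to n > 2. *)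
  - by rewrite card_parts; lia.
  - by case=> ? ?.
  - move=> p q i j neq_pq; apply: (parts_square_edge n n_prime (Gvtx n p i) (Gvtx n q j)).
    by case: p q neq_pq => ? [].
  - exact: choosable_list_chromatic_number.
(* The bounds combine as (3(n-1) + 1) - (2n-1) = n-1. *)
lia.
Qed.
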